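(* Consider the Gaussian mean return model. For an initial profile $(\Pi_1^0,\Pi_2^0)$, assume that the two agents iterate simultaneously by the one-agent update formula recalled in the context, and let $(\Pi_1^n,\Pi_2^n)$, $n=0,1,2,\dots$, be the resulting sequence; that is, for $n\ge1$ and $i,j\in\{1,2\}$, $i\ne j$, at time $t$ and state $Y(t)=y$, for $p\in(0,1)$, $$Q_{\Pi_i^n(t)}(p)=\frac{y}{\gamma_i\sigma}+k_i\mu_j^{n-1}(t)-\frac{\rho v}{\sigma}\big(a_2^{in}(t)y+a_1^{in}(t)\big)+\frac{\lambda_i(t)}{\gamma_i\sigma^2}h_i'(1-p),$$ where $\mu_j^{n-1}(t)$ is the mean of $\Pi_j^{n-1}(t)$ and $a_1^{in},a_2^{in}$ are given by the recursion in the context. Then for $p\in(0,1)$, $i,j\in\{1,2\}$ and $i\neq j$, $Q_{\Pi_i^n(t)}(p)$ converges uniformly, as $n\to\infty$, to $$Q_{\Pi_i^*(t)}(p)=\frac{1}{1-k_1k_2}\left[\frac y\sigma\Big(\frac1{\gamma_i}+\frac{k_i}{\gamma_j}\Big)-\frac{\rho v}\sigma\Big((a_2^i(t)+k_ia_2^j(t))y+(a_1^i(t)+k_ia_1^j(t))\Big)\right]+\frac{\lambda_i(t)}{\gamma_i\sigma^2}h_i'(1-p),$$ where, for $l\in\{1,2\}$, $$a_1^l(t)=\frac{\iota\bar Y}{\gamma_l(\iota+\rho v)^2}\big[1-e^{-(\iota+\rho v)(T-t)}\big]^2,\qquad a_2^l(t)=\frac1{\gamma_l(\iota+\rho v)}\big[1-e^{-2(\iota+\rho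 v)(T-t)}\big].$$
   Context: Gaussian mean return model. Fix $T>0$, $\rho\in[0,1]$, positive constants $r,\sigma,\iota,v,\bar Y$ and independent Brownian motions $B,\widetilde B,\overline B_1,\overline B_2$ on a filtered probability space with filtration $\{\mathcal F_t\}$. The risk-free rate is $r$, the stock satisfies $dS(t)/S(t)=(r+\sigma Y(t))dt+\sigma dB(t)$ and the state satisfies $dY(t)=\iota(\bar Y-Y(t))dt+v[\rho\,dB(t)+\sqrt{1-\rho^2}\,d\widetilde B(t)]$. Agents. For $i\in\{1,2\}$: $\gamma_i>0$ (risk aversion), $k_i\in(0,1)$ (sensitivity to the opponent), $\lambda_i:[0,T]\to(0,\infty)$ (exploration weight) and $h_i:[0,1]\to\mathbb R$ concave, of bounded variation, with $h_i(0)=h_i(1)=0$ and (a.e.) derivative $h_i'$. $\mathcal M$ is the set of Borel probability measures on $\mathbb R$; $Q_\Pi(p)=\inf\{x:\Pi((-\infty,x])\ge p\}$; $\Phi_{h}(\Pi)=\int_{\mathbb R}h(\Pi([x,\infty)))dx$. A policy $\Pi_i=(\Pi_i(t))_t$ has values in $\mathcal M$, with means $\mu_i(t)$ and variances $\sigma_i^2(t)$. The discounted exploratory wealth satisfies $dX_i^{\Pi_i}=\sigma Y\mu_i\,dt+\sigma[\mu_i\,dB+\sigma_i\,d\overline B_i]$, and $\hat X_i^{\Pi_i,\Pi_j}=X_i^{\Pi_i}-k_iX_j^{\Pi_j}$. Profile. Given $\Pi_j$, $\Pi_i\in\mathcal A(\Pi_j)$ (admissible feedback control) if: (i) $\Pi_i(s)\in\mathcal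 M$ for each $s\in[t,T]$; (ii) $\Pi_i(s)=\pi_i(s,\hat X_i^{\Pi_i,\Pi_j}(s),Y(s))$ for a deterministic map $\pi_i$ into $\mathcal M$; (iii) for every Borel $A$, $\{\Pi_i(s)(A)\}_s$ is $\mathcal F_s$-progressively measurable; (iv) $\mathbb E_t\int_t^T[|\sigma Y(\mu_i-k_i\mu_j)|+\sigma^2(\mu_i^2+\sigma_i^2)]ds<\infty$; (v) $\mathbb E_t\int_t^T|\lambda_i\Phi_{h_i}(\Pi_i)|ds<\infty$, with $\mathbb E_t$ the conditional expectation given the state at time $t$. A pair $(\Pi_1,\Pi_2)$ is a profile if $\Pi_1\in\mathcal A(\Pi_2)$ and $\Pi_2\in\mathcal A(\Pi_1)$. One-agent update formula. When the opponent's policy $\Pi_j$, with mean $\mu_j(t)$, is held fixed, the initial policy of Agent $i$ has, at state $Y(t)=y$, quantile function $$Q_{\Pi_i^0(t)}(p)=\frac{y}{\gamma_i\sigma}+k_i\mu_j(t)-\frac{\rho v}{\sigma}\big(a_2^{i0}(t)y+a_1^{i0}(t)\big)+\theta^0h_i'(1-p)$$ ($a_1^{i0},a_2^{i0},\theta^0$ being the initial policy's parameters), and for $n\ge1$ the updated policy has quantile function $$Q_{\Pi_i^n(t)}(p)=\frac{y}{\gamma_i\sigma}+k_i\mu_j(t)-\frac{\rho v}{\sigma}\big(a_2^{in}(t)y+a_1^{in}(t)\big)+\frac{\lambda_i(t)}{\gamma_i\sigma^2}h_i'(1-p),$$ where $$(a_2^{in})'=2\iota a_2^{in}+2\rho v\,a_2^{i(n-1)}-\frac2{\gamma_i},\quad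 a_2^{in}(T)=0,\qquad (a_1^{in})'=\iota a_1^{in}+\rho v\,a_1^{i(n-1)}-\iota\bar Ya_2^{in},\quad a_1^{in}(T)=0.$$
   Formalization: Each h_i is assumed continuous on [0,1] (the claim fails for h(0)=0, h(p)=1-p for p>0), and the initial parameters a_1^{i0}, a_2^{i0} are assumed continuous on [0,T]; uniform convergence is in t, p and in y over compact sets. *)

(* Defs.v *)
From HB Require Import structures.
From mathcomp Require Import all_boot all_order all_algebra.
From mathcomp Require Import all_classical all_reals all_analysis.

Set Implicit Arguments.
Unset Strict Implicit.
Unset Printing Implicit Defensive.

Import Order.TTheory GRing.Theory Num.Theory.
Import numFieldTopology.Exports numFieldNormedType.Exports.

Local Open Scope classical_set_scope.
Local Open Scope ring_scope.

Notation prob_on R := (probability (measurableTypeR R) R).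

Definition quantile (R : realType) (Pi : prob_on R) (p : R) : R :=
  inf [set x : R | (p%:E <= Pi `]-oo, x]%classic)%E].

Definition mean (R : realType) (Pi : prob_on R) : R :=
  fine (expectation Pi (fun x : R => x)).

(* Extended-real: equal to +oo when Pi has no finite second moment, including
   when Pi has no mean. *)
Definition var (R : realType) (Pi : prob_on R) : \bar R :=
  variance Pi (fun x : R => x).

Definition choquet (R : realType) (h : R -> R) (Pi : prob_on R) : \bar R :=
  (\int[lebesgue_measure]_x (h (fine (Pi `[x, +oo[%classic)))%:E)%E.

(* The two drivers of the market (B for the stock, tilde B for the state) are
   inl true and inl false; inr i is the exploration noise of agent i. *)
Notation noise := (bool + 'I_2)%type.

Section StochasticCalculus.
Context (d : measure_display) (Omega : measurableType d) (R : realType).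
Variables (P : probability Omega R) (F : R -> set (set Omega)).

Definition filtration : Prop :=
  (forall s, 0 <= s -> sigma_algebra setT (F s) /\ F s `<=` measurable) /\
  (forall s t, 0 <= s -> s <= t -> F s `<=` F t).

Definition measurable_at (s : R) (X : Omega -> R) : Prop :=
  forall U : set R, measurable U -> F s (X @^-1` U).

Definition progressive (t0 T : R) (X : R -> Omega -> R) : Prop :=
  forall s, t0 <= s <= T ->
    measurable_fun
      (`[t0, s] `*` setT : set (measurableTypeR R * g_sigma_algebraType (F s)))
      (fun z : measurableTypeR R * g_sigma_algebraType (F s) => X z.1 z.2).

Definition increment (W : R -> Omega -> R) (s t : R) (w : Omega) : R :=
  W t w - W s w.

Definition brownian (W : R -> Omega -> R) : Prop :=
  [/\ (\forall w \ae P, W 0 w = 0),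
      (forall w, {within `[0, +oo[, continuous (W ^~ w)}),
      (forall s, 0 <= s -> measurable_at s (W s)),
      (forall s t, 0 <= s -> s < t -> forall U : set R, measurable U ->
         P (increment W s t @^-1` U) = normal_prob 0 (Num.sqrt (t - s)) U) &
      (forall s t, 0 <= s -> s < t -> forall (A : set Omega) (U : set R),
         F s A -> measurable U ->
         P (A `&` increment W s t @^-1` U) =
         (P A * P (increment W s t @^-1` U))%E)].

Definition history (W : R -> Omega -> R) : set (set Omega) :=
  <<s [set A | exists s (U : set R),
        [/\ 0 <= s, measurable U & A = W s @^-1` U]] >>.

Definition independent_processes (I : finType) (W : I -> R -> Omega -> R) : Prop :=
  forall A : I -> set Omega, (forall k, history (W k) (A k)) ->
    fine (P (\bigcap_(k in setT) A k)) = \prod_(k : I) fine (P (A k)).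

(* sum over k < steps of level_k 1_(]knot_k, knot_(k+1)]) *)
Record simple_process := SimpleProcess {
  steps : nat;
  knot : nat -> R;
  level : nat -> Omega -> R }.

Definition simple_on (t0 T : R) (G : simple_process) : Prop :=
  [/\ knot G 0%N = t0, knot G (steps G) = T,
      (forall k, (k < steps G)%N -> knot G k <= knot G k.+1),
      (forall k, (k < steps G)%N -> measurable_at (knot G k) (level G k)) &
      (exists M, forall k w, (k < steps G)%N -> `|level G k w| <= M)].

Definition simple_value (G : simple_process) (u : R) (w : Omega) : R :=
  \sum_(k < steps G) level G k w * \1_(`]knot G k, knot G k.+1]) u.

Definition simple_integral (G : simple_process) (W : R -> Omega -> R)
    (s : R) (w : Omega) : R :=
  \sum_(k < steps G)
    level G k w * (W (Num.min (knot G k.+1) s) w - W (Num.min (knot G k) s) w).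

(* I s is the L^2 Ito integral of H against W over [t0, s], for t0 <= s <= T *)
Definition ito_integral (t0 T : R) (W H I : R -> Omega -> R) : Prop :=
  [/\ progressive t0 T H,
      (forall s, t0 <= s <= T -> measurable_fun setT (I s)),
      (\forall w \ae P, {within `[t0, T], continuous (I ^~ w)}) &
      exists G : nat -> simple_process,
        [/\ (forall n, simple_on t0 T (G n)),
            (fun n => \int[P]_w \int[lebesgue_measure]_(u in `[t0, T])
              ((simple_value (G n) u w - H u w) ^+ 2)%:E)%E @ \oo --> 0%E &
            (forall s, t0 <= s <= T ->
              (fun n => \int[P]_w
                ((simple_integral (G n) W s w - I s w) ^+ 2)%:E)%E
              @ \oo --> 0%E)]].

(* dX = b dt + sum_k D_k dW_k on [t0, T], X(t0) = x0 *)
Definition ito_process (W : noise -> R -> Omega -> R) (t0 T x0 : R)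
    (b : R -> Omega -> R) (D : noise -> R -> Omega -> R)
    (X : R -> Omega -> R) : Prop :=
  progressive t0 T X /\
  exists I : noise -> R -> Omega -> R,
    (forall k, ito_integral t0 T (W k) (D k) (I k)) /\
    (\forall w \ae P,
       (@lebesgue_measure R).-integrable `[t0, T] (EFin \o (b ^~ w)) /\
       forall s, t0 <= s <= T ->
         X s w = x0 + \int[lebesgue_measure]_(u in `[t0, s]) b u w
                 + \sum_(k : noise) I k s w).

End StochasticCalculus.

Record market (R : realType) := Market {
  horizon : R;
  rho : R;
  rate : R;
  sigma : R;
  iota : R;
  vol : R;
  Ybar : R;
  horizon_gt0 : 0 < horizon;
  rho_itv : 0 <= rho <= 1;
  rate_gt0 : 0 < rate;
  sigma_gt0 : 0 < sigma;
  iota_gt0 : 0 < iota;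
  vol_gt0 : 0 < vol;
  Ybar_gt0 : 0 < Ybar }.

(* dh is an arbitrary version of the a.e. derivative of h. A concave h is
   automatically continuous on ]0, 1[ but may jump at 0 and 1; continuity on the
   closed interval makes h the integral of dh. *)
Record agent (R : realType) (T : R) := Agent {
  gamma : R;
  kappa : R;
  lambda : R -> R;
  h : R -> R;
  dh : R -> R;
  gamma_gt0 : 0 < gamma;
  kappa_itv : 0 < kappa < 1;
  lambda_gt0 : forall t, 0 <= t <= T -> 0 < lambda t;
  h_concave : convex_function (`[0, 1]%classic : set R^o) (fun x : R^o => - h x);
  h_bv : bounded_variation 0 1 h;
  h_0 : h 0 = 0;
  h_1 : h 1 = 0;
  h_continuous : {within `[0, 1], continuous h};
  h_derive : \forall p \ae (@lebesgue_measure R),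
    0 < p < 1 -> is_derive (p : R^o) 1 (h : R^o -> R^o) (dh p) }.

Section Game.
Context (d : measure_display) (Omega : measurableType d) (R : realType).
Variables (P : probability Omega R) (F : R -> set (set Omega)).
Variables (W : noise -> R -> Omega -> R).
Variables (m : market R) (ag : 'I_2 -> agent (horizon m)).

Local Notation T := (horizon m).

Definition brownian_noise : Prop :=
  (forall k, brownian P F (W k)) /\ independent_processes P W.

Definition stock_sde (t0 s0 : R) (Y S : R -> Omega -> R) : Prop :=
  ito_process P F W t0 T s0
    (fun s w => S s w * (rate m + sigma m * Y s w))
    (fun k s w => if k is inl true then sigma m * S s w else 0)
    S.

Definition state_sde (t0 y0 : R) (Y : R -> Omega -> R) : Prop :=
  ito_process P F W t0 T y0
    (fun s w => iota m * (Ybar m - Y s w))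
    (fun k _ _ => match k with
       | inl true => vol m * rho m
       | inl false => vol m * Num.sqrt (1 - rho m ^+ 2)
       | inr _ => 0
       end)
    Y.

Definition wealth_sde (i : 'I_2) (t0 x0 : R) (Y : R -> Omega -> R)
    (Pi : R -> Omega -> prob_on R) (X : R -> Omega -> R) : Prop :=
  ito_process P F W t0 T x0
    (fun s w => sigma m * Y s w * mean (Pi s w))
    (fun k s w => match k with
       | inl true => sigma m * mean (Pi s w)
       | inl false => 0
       | inr l => if l == i then sigma m * Num.sqrt (fine (var (Pi s w))) else 0
       end)
    X.

Definition admissible (i : 'I_2) (t0 : R) (Y : R -> Omega -> R)
    (Pi_i Pi_j : R -> Omega -> prob_on R) : Prop :=
  [/\ (forall A : set R, measurable A ->
         progressive F t0 T (fun s w => fine (Pi_i s w A))),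
      (\int[P]_w \int[lebesgue_measure]_(s in `[t0, T])
         (`|sigma m * Y s w *
             (mean (Pi_i s w) - kappa (ag i) * mean (Pi_j s w))|%:E
          + (sigma m ^+ 2)%:E * ((mean (Pi_i s w) ^+ 2)%:E + var (Pi_i s w)))
       < +oo)%E &
      (\int[P]_w \int[lebesgue_measure]_(s in `[t0, T])
         `| (lambda (ag i) s)%:E * choquet (h (ag i)) (Pi_i s w) | < +oo)%E].

(* pi i s x y is the distribution played by agent i at time s when the relative
   wealth of agent i is x and the state is y. The conditional expectation given
   the state at time t0 is the expectation for the system started from that state
   at time t0. *)
Definition profile (pi : 'I_2 -> R -> R -> R -> prob_on R) : Prop :=
  forall (t0 s0 y0 : R) (x0 : 'I_2 -> R), 0 <= t0 <= T -> 0 < s0 ->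
  exists (S Y : R -> Omega -> R) (X : 'I_2 -> R -> Omega -> R)
         (Pi : 'I_2 -> R -> Omega -> prob_on R),
    [/\ stock_sde t0 s0 Y S,
        state_sde t0 y0 Y,
        (forall i j : 'I_2, i != j -> forall s w,
           Pi i s w = pi i s (X i s w - kappa (ag i) * X j s w) (Y s w)),
        (forall i, wealth_sde i t0 (x0 i) Y (Pi i) (X i)) &
        (forall i j : 'I_2, i != j -> admissible i t0 Y (Pi i) (Pi j))].

(* The quantile function, at state y, of a policy of agent i with hedging
   coefficients a1 and a2 and exploration scale theta, against an opponent whose
   policy has mean mu. *)
Definition response_quantile (i : 'I_2) (mu a1 a2 theta y p : R) : R :=
  y / (gamma (ag i) * sigma m) + kappa (ag i) * mu
  - rho m * vol m / sigma m * (a2 * y + a1) + theta * dh (ag i) (1 - p).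

(* a1 n and a2 n are the coefficients of agent i after n updates *)
Definition coef_recursion (i : 'I_2) (a1 a2 : nat -> R -> R) : Prop :=
  [/\ {within `[0, T], continuous (a1 0%N)},
      {within `[0, T], continuous (a2 0%N)} &
      forall n,
      [/\ {within `[0, T], continuous (a2 n.+1)},
          (forall t : R, 0 < t < T -> is_derive (t : R^o) 1 (a2 n.+1 : R^o -> R^o)
             (2 * iota m * a2 n.+1 t + 2 * rho m * vol m * a2 n t
              - 2 / gamma (ag i))),
          a2 n.+1 T = 0,
          {within `[0, T], continuous (a1 n.+1)} &
          (forall t : R, 0 < t < T -> is_derive (t : R^o) 1 (a1 n.+1 : R^o -> R^o)
             (iota m * a1 n.+1 t + rho m * vol m * a1 n t
              - iota m * Ybar m * a2 n.+1 t)) /\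
          a1 n.+1 T = 0]].

Definition a1_star (l : 'I_2) (t : R) : R :=
  iota m * Ybar m / (gamma (ag l) * (iota m + rho m * vol m) ^+ 2)
  * (1 - expR (- (iota m + rho m * vol m) * (T - t))) ^+ 2.

Definition a2_star (l : 'I_2) (t : R) : R :=
  1 / (gamma (ag l) * (iota m + rho m * vol m))
  * (1 - expR (- 2 * (iota m + rho m * vol m) * (T - t))).

End Game.

(* Main.v *)
From HB Require Import structures.
Require Import Defs.
From mathcomp Require Import all_boot all_order all_algebra.
From mathcomp Require Import all_classical all_reals all_analysis.
From mathcomp Require Import measurable_realfun ring lra.
Import Order.TTheory GRing.Theory Num.Theory.
Import numFieldTopology.Exports numFieldNormedType.Exports.
Local Open Scope classical_set_scope.
Local Open Scope ring_scope.

(** Integrating the quantile functions over ]0, 1[ kills the exploration term,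
    since the integral of h' is h 1 - h 0 = 0; hence the means solve
    mu_i^(n+1) = k_i mu_j^n + (a term converging geometrically, locally uniformly in y),
    a contraction because k_i < 1, whose fixed point is the mean of the limit.
    The coefficients a_2^n and a_1^n converge geometrically by a Picard-type
    contraction in a weighted sup norm.  The mean exists although h' may be unbounded
    at 0 and 1: h' is nonincreasing because quantile functions are monotone, so by
    concavity it is everywhere on ]0, 1[ a supergradient of h, and comparing with
    Riemann sums gives the fundamental theorem of calculus for h. *)

(** * Geometric decay *)

(** The rate is existential because each contraction argument below worsens it. *)
Definition geometric_decay {R : realType} {U : Type} (D : set U)
    (f : nat -> U -> R) : Prop :=
  exists C r, [/\ 0 <= C, 0 <= r, r < 1 &
    forall n u, D u -> `|f n u| <= C * r ^+ n].

(** A contraction of ratio q driven by a forcing of order [r ^+ n]. Quantifying over all bounds M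
    stands in for the sup norm on D. *)
Lemma contraction_decay {R : realType} {U : Type} (D : set U)
    (f : nat -> U -> R) (q A r : R) :
  0 <= q < 1 -> 0 <= r < 1 ->
  (exists M, forall u, D u -> `|f 0%N u| <= M) ->
  (forall n M, (forall u, D u -> `|f n u| <= M) ->
     forall u, D u -> `|f n.+1 u| <= q * M + A * r ^+ n) ->
  geometric_decay D f.
Proof.
move=> /andP[q0 q1] /andP[r0 r1] [M0 f0] fS.
(* The rate must exceed both q and r strictly: when they coincide, the iterates can be of order
   [n * q ^+ n]. *)
pose s := (1 + Num.max q r) / 2.
have [qm rm] : q <= Num.max q r /\ r <= Num.max q r.
  by rewrite !le_max !lexx orbT.
have m1 : Num.max q r < 1 by rewrite gt_max q1 r1.
have qs : q < s by rewrite /s; lra.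
have rs : r < s by rewrite /s; lra.
have s1 : s < 1 by rewrite /s; lra.
have s0 : 0 <= s by rewrite (le_trans q0)// ltW.
pose C := `|M0| + `|A| / (s - q).
have sq : 0 < s - q by rewrite subr_gt0.
have AC : `|A| <= C * (s - q).
  rewrite /C mulrDl divfK ?gt_eqF// lerDr mulr_ge0// ltW//.
have C0 : 0 <= C by rewrite /C addr_ge0// divr_ge0// ltW.
exists C, s; split=> // n; elim: n => [|n IH] u Du.
  rewrite expr0 mulr1 (le_trans (f0 u Du))// (le_trans (ler_norm _))//.
  by rewrite /C lerDl divr_ge0// ltW.
apply: (le_trans (fS n _ IH u Du)).
have Ar : A * r ^+ n <= `|A| * s ^+ n.
  rewrite (le_trans (ler_norm _))// normrM (ger0_norm (exprn_ge0 _ _))//.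
  by rewrite ler_wpM2l// lerXn2r ?nnegrE// ltW.
have : `|A| * s ^+ n <= C * (s - q) * s ^+ n by rewrite ler_wpM2r// exprn_ge0.
rewrite exprS; nra.
Qed.

(** The index is shifted because only the policies from the first update on carry the exploration
    scale of the limit. *)
Lemma geometric_decay_uniform {R : realType} {U : choiceType} (D : set U)
    (f : nat -> U -> R) (g : U -> R) :
  geometric_decay D (fun n u => f n.+1 u - g u) -> {uniform D, f @ \oo --> g}.
Proof.
move=> [C [r [C0 r0 r1 fg]]].
have rC : (fun n => C * r ^+ n) @ \oo --> 0.
  by apply: cvg_geometric; rewrite ger0_norm.
move=> P /uniform_nbhs[E [entE EP]].
have := entE; rewrite -entourage_from_ballE => -[e /= e0 eE].
have [N _ NE] : \forall n \near \oo, C * r ^+ n < e.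
  move/cvgrPdist_lt: rC => /(_ e e0); apply: filterS => n.
  by rewrite sub0r normrN; apply: le_lt_trans; exact: ler_norm.
exists N.+1 => // -[//|n] /= Nn.
apply: EP => u Du; apply: eE; rewrite /ball/= distrC.
exact: le_lt_trans (fg n u Du) (NE n Nn).
Qed.

(** Here y plays the state: its boundedness on D is what confines the convergence to compact sets of
    states. *)
Lemma geometric_decay_lincomb (R : realType) (U : Type) (D : set U)
    (f g : nat -> U -> R) (c : R) (y : U -> R) (B : R) :
  (forall u, D u -> `|y u| <= B) -> geometric_decay D f -> geometric_decay D g ->
  geometric_decay D (fun n u => c * (f n u * y u + g n u)).
Proof.
move=> yB [C [r [C0 r0 r1 fC]]] [C' [r' [C'0 r'0 r'1 gC]]].
exists (`|c| * (C * `|B| + C')), (Num.max r r'); split.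
- by rewrite mulr_ge0// addr_ge0// mulr_ge0.
- by rewrite le_max r0.
- by rewrite gt_max r1.
move=> n u Du; rewrite normrM -mulrA ler_wpM2l// (le_trans (ler_normD _ _))//.
have [rm r'm] : r <= Num.max r r' /\ r' <= Num.max r r'.
  by rewrite !le_max !lexx orbT.
rewrite mulrDl lerD//.
  rewrite normrM mulrAC ler_pM//.
    rewrite (le_trans (fC n u Du))// ler_wpM2l// lerXn2r ?nnegrE//.
    exact: le_trans rm.
  by rewrite (le_trans (yB u Du))// ler_norm.
rewrite (le_trans (gC n u Du))// ler_wpM2l// lerXn2r ?nnegrE//.
exact: le_trans r'm.
Qed.

(** * Coupled recursion of the two means *)

Section means.
Context {R : realType} {U : Type}.
Variables (D : set U) (k : 'I_2 -> R) (x w : nat -> 'I_2 -> U -> R).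
Hypothesis k01 : forall i, 0 < k i < 1.
Hypothesis x0 : forall i j u, i != j -> D u -> x 0%N i u = k i * x 0%N j u + w 0%N i u.
Hypothesis xS : forall n i j u, i != j -> D u -> x n.+1 i u = k i * x n j u + w n.+1 i u.

(** Taking the supremum over both agents turns the pair of recursions into one contraction, of ratio
    the larger [k i]. The starting bound comes from [x0], where both agents appear at the same
    index. *)
Lemma coupled_decay : (forall i, geometric_decay D (fun n => w n i)) ->
  forall i, geometric_decay D (fun n => x n i).
Proof.
move=> wD.
have [A [r [A0 r0 r1 wA]]] : exists A r, [/\ 0 <= A, 0 <= r, r < 1 &
    forall n i u, D u -> `|w n i u| <= A * r ^+ n].
  have [A [r [A0 r0 r1 wA]]] := wD ord0.
  have [B [s [B0 s0 s1 wB]]] := wD ord_max.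
  exists (A + B), (Num.max r s); split.
  - by rewrite addr_ge0.
  - by rewrite le_max r0.
  - by rewrite gt_max r1.
  move=> n i u Du.
  have rn : A * r ^+ n <= A * Num.max r s ^+ n.
    by rewrite ler_wpM2l// lerXn2r ?nnegrE ?le_max ?r0 ?lexx.
  have sn : B * s ^+ n <= B * Num.max r s ^+ n.
    by rewrite ler_wpM2l// lerXn2r ?nnegrE ?le_max ?r0 ?lexx ?orbT.
  have p0 : 0 <= Num.max r s ^+ n by rewrite exprn_ge0// le_max r0.
  rewrite mulrDl; have [->|->] : i = ord0 \/ i = ord_max.
    by case: i => -[|[|//]] ?; [left|right]; exact: val_inj.
  - by have := wA n u Du; have := mulr_ge0 B0 p0; lra.
  - by have := wB n u Du; have := mulr_ge0 A0 p0; lra.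
pose q := Num.max (k ord0) (k ord_max).
have kq i : k i <= q.
  rewrite /q le_max; have [->|->] : i = ord0 \/ i = ord_max.
    by case: i => -[|[|//]] ?; [left|right]; exact: val_inj.
  by rewrite lexx. by rewrite lexx orbT.
have q01 : 0 <= q < 1.
  apply/andP; split; last first.
    by rewrite gt_max; have /andP[_ ->] := k01 ord0; have /andP[_ ->] := k01 ord_max.
  by rewrite (le_trans _ (kq ord0))// ltW//; have /andP[] := k01 ord0.
have other (i : 'I_2) : exists j, i != j.
  by case: i => -[|[|//]] ?; [exists ord_max|exists ord0].
have : geometric_decay [set iu | D iu.2] (fun n (iu : 'I_2 * U) => x n iu.1 iu.2).
  (* The forcing at the next index is at most [A * r ^+ n.+1], hence the constant [A * r]. *)
  apply: (@contraction_decay R _ _ _ q (A * r) r) => //.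
  - by rewrite r0.
  - exists (A / (1 - q)) => -[i u] /= Du.
    have xq i' j' : i' != j' -> `|x 0%N i' u| <= q * `|x 0%N j' u| + A.
      move=> ij; rewrite (x0 _ _ u ij Du) (le_trans (ler_normD _ _))// lerD//.
        by have /andP[ki0 _] := k01 i'; rewrite normrM gtr0_norm// ler_wpM2r.
      by have := wA 0%N i' u Du; rewrite expr0 mulr1.
    have [j ij] := other i.
    have := xq _ _ ij; have := xq j i; rewrite eq_sym => /(_ ij).
    move: q01 => /andP[q0 q1] ji ij'; rewrite ler_pdivlMr ?subr_gt0//.
    suff : `|x 0%N i u| * (1 - q) * (1 + q) <= A * (1 + q) by rewrite ler_pM2r//; lra.
    nra.
  - move=> n M xM [i u] /= Du; have [j ij] := other i.
    rewrite (xS n _ _ u ij Du) (le_trans (ler_normD _ _))// lerD//; last first.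
      by rewrite -mulrA -exprS wA.
    have /andP[ki0 _] := k01 i.
    rewrite normrM gtr0_norm//.
    have xMj := xM (j, u) Du.
    have M0 : 0 <= M by rewrite (le_trans _ xMj).
    have := kq i; move: xMj => /=; have := normr_ge0 (x n j u); nra.
move=> [C [s [? ? ? xC]]] i; exists C, s; split => // n u Du.
exact: (xC n (i, u)).
Qed.
End means.

(** * Linear backward equations and the hedging coefficients *)

(** Comparison with the supersolution [S / (al + be) * expR (be * (T - t))]: its gap to e, times the
    integrating factor [expR (- al * t)], is nonincreasing and nonnegative at T. *)
Lemma linear_ode_upper (R : realType) (T al be S : R) (e s : R -> R) :
  0 < al + be -> {within `[0, T], continuous e} ->
  (forall t, 0 < t < T -> is_derive (t : R^o) 1 (e : R^o -> R^o) (al * e t + s t)) ->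
  e T = 0 -> 0 <= S -> (forall t, 0 < t < T -> `|s t| <= S * expR (be * (T - t))) ->
  forall t, 0 <= t <= T -> e t <= S / (al + be) * expR (be * (T - t)).
Proof.
move=> ab0 ce de eT S0 sS t /andP[t0 tT].
pose q := S / (al + be).
pose u (x : R) : R := expR (- al * x) * (q * expR (be * (T - x)) - e x).
have q0 : 0 <= q by rewrite divr_ge0// ltW.
have du x : x \in `]0, T[ -> is_derive (x : R^o) 1 (u : R^o -> R^o)
    (- expR (- al * x) * ((al + be) * q * expR (be * (T - x)) + s x)).
  rewrite in_itv/= => xT; have dex := de x xT.
  rewrite /u; apply: is_derive_eq.
  rewrite !scaler1 /GRing.scale/=; ring.
have cexp c : continuous (fun z : R => expR (c * z)).
  move=> z; apply: (@continuous_comp _ _ _ (fun z : R => c * z) expR).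
    by apply: cvgM; [exact: cvg_cst|exact: cvg_id].
  exact: continuous_expR.
have cu : {within `[0, T], continuous u}.
  move=> x; apply: cvgM; first exact: (continuous_subspaceT (cexp (- al))).
  apply: cvgB; last exact: ce.
  apply: cvgM; first exact: cvg_cst.
  have c2 : continuous (fun z => expR (be * (T - z))).
    move=> z; apply: (@continuous_comp _ _ _ (fun z : R => T - z) (fun z => expR (be * z))).
      by apply: cvgB; [exact: cvg_cst|exact: cvg_id].
    exact: cexp.
  exact: (continuous_subspaceT c2).
have uE x : u x = expR (- al * x) * (q * expR (be * (T - x)) - e x) by [].
clearbody u.
have : u T <= u t.
  apply: (@ler0_derive1_le_cc _ u 0 T _ _ cu T t _ _ tT).
  - by move=> x xT; have := du x xT => /@ex_derive.
  - move=> x xT; rewrite derive1E; have dux := du x xT; rewrite derive_val.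
    rewrite mulNr oppr_le0 mulr_ge0 ?expR_ge0//.
    rewrite /q [_ * (S / _)]mulrC divfK ?gt_eqF//.
    have := sS x; move: xT; rewrite in_itv/= => xT /(_ xT).
    by rewrite ler_norml => /andP[]; lra.
  - by rewrite in_itv/= lexx (le_trans t0).
  - by rewrite in_itv/= t0.
rewrite !uE eT subr0 subrr mulr0 expR0 mulr1 => H.
have : 0 <= expR (- al * t) * (q * expR (be * (T - t)) - e t).
  by rewrite (le_trans _ H)// mulr_ge0// expR_ge0.
by rewrite pmulr_rge0 ?expR_gt0// subr_ge0.
Qed.

Lemma linear_ode_bound (R : realType) (T al be S : R) (e s : R -> R) :
  0 < al + be -> {within `[0, T], continuous e} ->
  (forall t, 0 < t < T -> is_derive (t : R^o) 1 (e : R^o -> R^o) (al * e t + s t)) ->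
  e T = 0 -> 0 <= S -> (forall t, 0 < t < T -> `|s t| <= S * expR (be * (T - t))) ->
  forall t, 0 <= t <= T -> `|e t| <= S / (al + be) * expR (be * (T - t)).
Proof.
move=> ab0 ce de eT S0 sS t tT; rewrite ler_norml; apply/andP; split.
  rewrite lerNl.
  apply: (@linear_ode_upper R T al be S (fun x => - e x) (fun x => - s x)) => //.
  - by move=> x; apply: cvgN; exact: ce.
  - move=> x xT; have dex := de x xT.
    by apply: is_derive_eq; rewrite mulrN -opprD.
  - by rewrite eT oppr0.
  - by move=> x xT; rewrite normrN; exact: sS.
exact: (@linear_ode_upper R T al be S e s).
Qed.

(* In the norm sup |x t| / exp (c (T - t)) the update is a contraction of ratio
   c / (al + c). *)
Lemma ode_iteration_decay (R : realType) (T al c : R) (x w : nat -> R -> R) :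
  0 < al -> 0 <= c -> 0 < T ->
  (forall n, {within `[0, T], continuous (x n)}) ->
  (forall n t, 0 < t < T ->
     is_derive (t : R^o) 1 (x n.+1 : R^o -> R^o) (al * x n.+1 t + (c * x n t + w n t))) ->
  (forall n, x n.+1 T = 0) ->
  geometric_decay `[0, T] w -> geometric_decay `[0, T] x.
Proof.
move=> al0 c0 T0 cx dx xT [A [r [A0 r0 r1 wA]]].
have ac : 0 < al + c by lra.
(* The weight is at least 1, so unweighted bounds on [x 0] and w are also weighted ones. *)
have E1 t : 0 <= t <= T -> 1 <= expR (c * (T - t)).
  move=> /andP[_ tT]; have := expR_ge1Dx (c * (T - t)).
  have : 0 <= c * (T - t) by rewrite mulr_ge0// subr_ge0.
  lra.
have nE (y z : R) : `|y / expR z| = `|y| / expR z.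
  by rewrite normrM normfV (ger0_norm (expR_ge0 _)).
have : geometric_decay `[0, T] (fun n t => x n t / expR (c * (T - t))).
  apply: (@contraction_decay R _ _ _ (c / (al + c)) (A / (al + c)) r).
  - by rewrite divr_ge0 ?(ltW ac)//= ltr_pdivrMr// mul1r; lra.
  - by rewrite r0.
  - have [|m mT xm] := @EVT_max R (fun t => `|x 0%N t|) 0 T (ltW T0).
      by move=> t; apply: cvg_norm; exact: cx.
    exists `|x 0%N m| => t /= tT.
    rewrite nE ler_pdivrMr ?expR_gt0// (le_trans (xm _ tT))// ler_peMr//; apply: E1.
    by move: tT; rewrite in_itv.
  - move=> n M xM t /= tT.
    have M0 : 0 <= M by rewrite (le_trans _ (xM t tT)).
    have tT' : 0 <= t <= T by move: tT; rewrite in_itv.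
    rewrite nE ler_pdivrMr ?expR_gt0//.
    have -> : c / (al + c) * M + A / (al + c) * r ^+ n =
              (c * M + A * r ^+ n) / (al + c) by field; rewrite gt_eqF.
    (* With [be := c] the source is bounded by [(c * M + A * r ^+ n)] times the weight. *)
    apply: (@linear_ode_bound R T al c _ _ _ ac (cx n.+1) (dx n) (xT n) _ _ t tT').
      by rewrite addr_ge0 ?mulr_ge0// exprn_ge0.
    move=> u /andP[u0 uT]; have uT' : u \in `[0, T] by rewrite in_itv/= !ltW.
    rewrite (le_trans (ler_normD _ _))// mulrDl lerD//.
      rewrite normrM (ger0_norm c0) -mulrA ler_wpM2l//.
      have := xM u uT'.
      by rewrite nE ler_pdivrMr ?expR_gt0.
    rewrite (le_trans (wA _ _ uT'))// ler_peMr ?mulr_ge0 ?exprn_ge0// E1//.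
move=> [C [r' [C0 r'0 r'1 xC]]].
(* Removing the weight costs at most its value at time 0. *)
exists (C * expR (c * T)), r'; split=> //; first by rewrite mulr_ge0// expR_ge0.
move=> n t tT; have := xC n t tT.
rewrite nE ler_pdivrMr ?expR_gt0//.
move=> /le_trans; apply; rewrite mulrAC ler_wpM2r ?exprn_ge0// ler_wpM2l// ler_expR.
by rewrite ler_wpM2l//; move: tT; rewrite /= in_itv/=; lra.
Qed.

Section coefficients.
Context {R : realType} {m : market R} {ag : 'I_2 -> agent (horizon m)}.
Local Notation T := (horizon m).
Local Notation rv := (rho m * vol m).

Lemma rv_ge0 : 0 <= rv.
Proof. by rewrite mulr_ge0 ?(ltW (vol_gt0 m))//; have /andP[] := rho_itv m. Qed.

Lemma iota_rv_gt0 : 0 < Defs.iota m + rv.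
Proof. by have := iota_gt0 m; have := rv_ge0; lra. Qed.

(** [a2_star] is a fixed point of the update, so the error solves the update equation without the
    constant source. *)
Lemma a2_star_derive l t : is_derive (t : R^o) 1 (a2_star ag l : R^o -> R^o)
  (2 * Defs.iota m * a2_star ag l t + (2 * rv * a2_star ag l t - 2 / gamma (ag l))).
Proof.
rewrite /a2_star; apply: is_derive_eq.
rewrite /GRing.scale/=; field.
by rewrite !gt_eqF ?gamma_gt0 ?iota_rv_gt0.
Qed.

Lemma a1_star_derive l t : is_derive (t : R^o) 1 (a1_star ag l : R^o -> R^o)
  (Defs.iota m * a1_star ag l t
   + (rv * a1_star ag l t - Defs.iota m * Ybar m * a2_star ag l t)).
Proof.
rewrite /a1_star /a2_star.
(* Exposes the second exponential as the square of the first, so that [field] sees a single atom. *)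
have -> : - 2 * (Defs.iota m + rv) * (T - t) =
   - (Defs.iota m + rv) * (T - t) + - (Defs.iota m + rv) * (T - t) by ring.
rewrite expRD.
apply: is_derive_eq.
rewrite /GRing.scale/=; field.
by rewrite !gt_eqF ?gamma_gt0 ?iota_rv_gt0.
Qed.

Lemma a_star_continuous l : continuous (a1_star ag l) /\ continuous (a2_star ag l).
Proof.
split=> t.
  have := a1_star_derive l t => /@ex_derive/derivable1_diffP.
  exact: differentiable_continuous.
have := a2_star_derive l t => /@ex_derive/derivable1_diffP.
exact: differentiable_continuous.
Qed.

Lemma a2_decay l (a1 a2 : nat -> R -> R) : coef_recursion ag l a1 a2 ->
  geometric_decay `[0, T] (fun n t => a2 n t - a2_star ag l t).
Proof.
move=> [_ c2 rec].
apply: (@ode_iteration_decay R T (2 * Defs.iota m) (2 * rv) _ (fun _ _ => 0)) => //; last 1 first.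
- by exists 0, 0; split=> // n u _; rewrite normr0 mul0r.
- by rewrite mulr_gt0// iota_gt0.
- by rewrite mulr_ge0// rv_ge0.
- exact: horizon_gt0.
- move=> n x; apply: cvgB.
    by case: n => [|n]; [exact: c2|case: (rec n) => + _ _ _ _; exact].
  by have [_ /continuous_subspaceT] := a_star_continuous l; apply.
- move=> n t tT; have [_ /(_ t tT) ? _ _ _] := rec n.
  have ? := a2_star_derive l t.
  by apply: is_derive_eq; ring.
- move=> n; have [_ _ -> _ _] := rec n.
  by rewrite /a2_star subrr mulr0 expR0 subrr mulr0 subrr.
Qed.

(** The error of [a2] at the same update enters as the forcing, so its decay has to come first. *)
Lemma a1_decay l (a1 a2 : nat -> R -> R) : coef_recursion ag l a1 a2 ->
  geometric_decay `[0, T] (fun n t => a1 n t - a1_star ag l t).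
Proof.
move=> rec_l; have [c1 _ rec] := rec_l.
have [C [r [C0 r0 r1 a2C]]] := a2_decay _ _ _ rec_l.
apply: (@ode_iteration_decay R T (Defs.iota m) rv _
  (fun n t => - (Defs.iota m * Ybar m) * (a2 n.+1 t - a2_star ag l t))) => //.
- by rewrite iota_gt0.
- by rewrite rv_ge0.
- exact: horizon_gt0.
- move=> n x; apply: cvgB.
    by case: n => [|n]; [exact: c1|case: (rec n) => _ _ _ + _; exact].
  by have [/continuous_subspaceT + _] := a_star_continuous l; apply.
- move=> n t tT; have [_ _ _ _ [/(_ t tT) ? _]] := rec n.
  have ? := a1_star_derive l t.
  by apply: is_derive_eq; ring.
- move=> n; have [_ _ _ _ [_ ->]] := rec n.
  by rewrite /a1_star subrr mulr0 expR0 subrr expr0n mulr0 subrr.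
- have iY : 0 <= Defs.iota m * Ybar m by rewrite mulr_ge0// ltW ?iota_gt0 ?Ybar_gt0.
  exists (Defs.iota m * Ybar m * C), r; split => //; first by rewrite mulr_ge0.
  move=> n t tT; rewrite normrM normrN (ger0_norm iY) -[leRHS]mulrA ler_wpM2l//.
  rewrite (le_trans (a2C _ t tT))// ler_wpM2l// exprS ler_piMl ?exprn_ge0//.
  exact: ltW.
Qed.

End coefficients.

(** * The mean as the integral of the quantile function *)

(** Half-open bounded intervals are stable under intersection, generate the Borel sets, and have as
    measure a difference of two values of the distribution function. *)
Lemma probability_cdf_unique (R : realType) (P Q : probability (measurableTypeR R) R) :
  (forall x : R, P `]-oo, x]%classic = Q `]-oo, x]%classic) ->
  forall A : set R, measurable A -> P A = Q A.
Proof.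
move=> PQ A mA.
pose g n : set (measurableTypeR R) := `](- n%:R), n%:R]%classic.
apply: (@g_sigma_algebra_measure_unique _ R (measurableTypeR R) (@ocitv R) _
    g _ _ P Q _ _ _ A mA).
- by move=> B [[a b] _ <-]; exact: measurable_itv.
- by move=> n; exact: is_ocitv.
- rewrite -subTset => x _; exists (Num.truncn `|x|).+1 => //=; rewrite /g/= in_itv/=.
  by have := truncnS_gt `|x|; rewrite ltr_norml => /andP[-> /ltW].
- exact: ocitvI.
- move=> B [[a b] _ <-] /=.
  have [ab|ba] := leP a b; last first.
    by rewrite set_itv_ge ?measure0// bnd_simp -leNgt ltW.
  have -> : `]a, b]%classic = `]-oo, b]%classic `\` `]-oo, a]%classic.
    by rewrite -[RHS]setCK setCD setCitvl setUC -[LHS]setCK setCitv.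
  have mD (M : probability (measurableTypeR R) R) :
      M (`]-oo, b] `\` `]-oo, a]) = (M `]-oo, b]%classic - M `]-oo, a]%classic)%E.
    have ioo : `]-oo, a] `<=` `]-oo, b] by exact: subset_itvl.
    by rewrite measureD ?(setIidr ioo)// -ge0_fin_numE// fin_num_measure.
  by rewrite !mD !PQ.
- by move=> n; rewrite -ge0_fin_numE// fin_num_measure//; exact: measurable_itv.
Qed.

Section quantile.
Context {R : realType} (Pi : prob_on R).
Local Notation mu := (@lebesgue_measure R).

(** The identity as a random variable under Pi gives access to the theory of [cdf]. *)
Let idT : measurableTypeR R -> R := idfun.

#[local] HB.instance Definition _ :=
  @isMeasurableFun.Build _ _ _ _ idT (@measurable_id _ _ setT).

Let f x : R := fine (Pi `]-oo, x]%classic).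

Let fE x : f x = fine (cdf (idT : {RV Pi >-> R}) x).
Proof. by rewrite /cdf /distribution /pushforward preimage_id. Qed.

Let fEFin x : Pi `]-oo, x]%classic = (f x)%:E.
Proof. by rewrite /f fineK// fin_num_measure. Qed.

Let f_nd x y : x <= y -> f x <= f y.
Proof.
move=> xy; rewrite !fE fine_le ?fin_num_measure//.
exact: cdf_nondecreasing.
Qed.

Let f_y : f @ +oo --> (1 : R).
Proof.
have -> : f = fun x => fine (cdf (idT : {RV Pi >-> R}) x).
  by apply/funext => x; exact: fE.
exact/fine_cvg/cvg_cdfy1.
Qed.

Let f_Ny : f @ -oo --> (0 : R).
Proof.
have -> : f = fun x => fine (cdf (idT : {RV Pi >-> R}) x).
  by apply/funext => x; exact: fE.
exact/fine_cvg/cvg_cdfNy0.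
Qed.

Let f_rc a : f x @[x --> a^'+] --> f a.
Proof.
have -> : f = fun x => fine (cdf (idT : {RV Pi >-> R}) x).
  by apply/funext => x; exact: fE.
by apply: fine_cvg; rewrite fineK ?fin_num_measure//; exact: cdf_right_continuous.
Qed.

(** For p inside ]0, 1[ the limits of the distribution function at both infinities make the infimum
    genuine, and right continuity makes it attained. *)
Lemma quantile_le (p x : R) : 0 < p < 1 ->
  (quantile Pi p <= x) = (p%:E <= Pi `]-oo, x]%classic)%E.
Proof.
move=> /andP[p0 p1]; rewrite fEFin lee_fin /quantile.
under eq_set do rewrite fEFin lee_fin.
set A := [set x | p <= f x].
have A0 : A !=set0.
  have [y] : \forall x \near +oo, p < f x by exact: (cvgr_gt _ f_y).
  move=> [_ yf]; exists (y + 1); rewrite /A/= ltW// yf// ltrDl//.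
have lA : has_lbound A.
  have [y] : \forall x \near -oo, f x < p by exact: (cvgr_lt _ f_Ny).
  move=> [_ yf]; exists (y - 1) => z /= pz; rewrite leNgt; apply/negP => zy.
  by have := yf (y - 1); rewrite ltrBlDr ltrDl ltr01 => /(_ isT); have := f_nd _ _ (ltW zy);
    have : p <= f z := pz; lra.
apply/idP/idP => [qx|px]; last exact: ge_inf.
rewrite (le_trans _ (f_nd _ _ qx))//.
rewrite leNgt; apply/negP => fp.
(* Otherwise f stays below p just to the right of [inf A], where A must have points. *)
have : \forall y \near (inf A)^'+, f y < p by exact: (cvgr_lt _ (f_rc _)).
rewrite /at_right/= => fy.
have [e /= e0 ey] : \forall y \near inf A, inf A < y -> f y < p by [].
have [y Ay yi] := inf_adherent e0 (conj A0 lA).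
have iy := ge_inf lA Ay.
have : f y < p.
  have [<-//|ne] := eqVneq (inf A) y.
  apply: ey; last by rewrite lt_neqAle ne.
  by rewrite /ball/= ler0_norm ?subr_le0//; lra.
by rewrite ltNge Ay.
Qed.

Lemma quantile_nondecreasing (p q : R) : 0 < p -> p <= q -> q < 1 ->
  quantile Pi p <= quantile Pi q.
Proof.
move=> p0 pq q1; have q01 : 0 < q < 1 by rewrite q1 (lt_le_trans p0).
rewrite quantile_le ?p0 ?(le_lt_trans pq)// (le_trans (_ : _ <= q%:E)%E) ?lee_fin//.
by rewrite -quantile_le.
Qed.

(* At p <= 0 and p > 1 the infimum defining [quantile] is a junk value. *)
Definition truncated_quantile (p : measurableTypeR R) : measurableTypeR R :=
  if (0 < p < 1) then quantile Pi p else 0.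

Lemma measurable_truncated_quantile : measurable_fun setT truncated_quantile.
Proof.
apply: measurable_fun_if => //.
  by apply: measurable_and; exact: measurable_fun_ltr.
have -> : [set: R] `&` (fun p => 0 < p < 1) @^-1` [set true] = `]0, 1[%classic.
  by apply/seteqP; split=> p /=; rewrite in_itv/= => // -[].
apply: (measurability (@RGenInftyO.G R)) => [|/= _ [_ [x ->] <-]].
  exact: RGenInftyO.measurableE.
apply: is_interval_measurable => p q/=.
rewrite !in_itv/= => -[/andP[p0 p1]] px [/andP[q0 q1]] qx z /andP[pz zq].
rewrite !in_itv/= (lt_le_trans p0)//= (le_lt_trans zq)//; split => //.
by rewrite (le_lt_trans _ qx)// quantile_nondecreasing// (lt_le_trans p0).
Qed.

#[local] HB.instance Definition _ :=
  @isMeasurableFun.Build _ _ _ _ truncated_quantile measurable_truncated_quantile.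

Local Notation unif := (uniform_prob (@ltr01 R)).

Lemma uniform01E (A : set R) : measurable A -> unif A = mu (A `&` `[0, 1]).
Proof.
move=> mA; rewrite /uniform_prob integral_uniform_pdf.
rewrite (eq_integral (fun=> 1%E)); last first.
  move=> x; rewrite inE /= in_itv/= => -[_ x01].
  by rewrite /uniform_pdf x01 subr0 invr1.
by rewrite integral_cst/= ?mul1e//; exact: measurableI.
Qed.

(** Inverse transform sampling: by [quantile_le], the event that the quantile is at most x is, up to
    endpoints, the interval from 0 to [f x]. *)
Lemma quantile_transform (A : set R) : measurable A ->
  Pi A = pushforward unif truncated_quantile A.
Proof.
move=> mA.
apply: (@probability_cdf_unique R Pi
  (distribution unif (truncated_quantile : {RV unif >-> measurableTypeR R})) _ A mA) => x.
transitivity (unif (truncated_quantile @^-1` `]-oo, x])); last by [].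
have mq : measurable (truncated_quantile @^-1` `]-oo, x]).
  rewrite -[X in measurable X]setTI.
  exact: measurable_truncated_quantile.
rewrite uniform01E//.
rewrite fEFin.
have f0 : 0 <= f x by rewrite /f fine_ge0.
have f1 : f x <= 1 by rewrite -lee_fin -fEFin probability_le1.
have itv01 (g : R) (a b : bool) : 0 <= g ->
    mu [set` Interval (BSide a 0) (BSide b g)] = g%:E.
  by move=> g0; rewrite lebesgue_measure_itv/= lte_fin; case: ltgtP g0 => // [fx|<-] _;
    rewrite ?EFinN ?oppr0 ?sube0 ?adde0.
apply/eqP; rewrite eq_le; apply/andP; split.
  rewrite -(itv01 (f x) false true f0) le_measure ?inE//.
    by apply: measurableI => //; exact: mq.
  move=> p /=; rewrite !in_itv/= => /andP[p0 pf].
  have p01 : 0 < p < 1 by rewrite p0 (lt_le_trans pf).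
  rewrite (ltW p0) (ltW (lt_le_trans pf f1)) /truncated_quantile p01; split=> //.
  by rewrite quantile_le// fEFin lee_fin ltW.
(* At 0 and 1 the truncated quantile takes the default value 0, so 1 may lie in the preimage even if
   [f x < 1]. *)
apply: (@le_trans _ _ (mu (`[0, f x] `|` [set 1]))).
  apply: le_measure; rewrite ?inE//.
    by apply: measurableI => //; exact: mq.
    by apply: measurableU.
  move=> p /=; rewrite !in_itv/= => -[+ /andP[]].
  rewrite !le_eqVlt => + /predU1P[<- _|p0 /predU1P[->|p1]].
  - by move=> _; left; rewrite eqxx/= -le_eqVlt.
  - by right.
  - rewrite -!le_eqVlt /truncated_quantile p0 p1/= quantile_le ?p0// fEFin lee_fin => ->.
    by left; rewrite ltW.
apply: (le_trans (measureU2 _ _ _)) => //.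
rewrite -[leRHS]adde0; apply: leeD.
  by have /= -> := itv01 (f x) true false f0.
by have /= -> := lebesgue_measure_set1 (1 : R).
Qed.

Let ge0_integral_quantile (g : R -> \bar R) : measurable_fun setT g -> (forall x, 0 <= g x)%E ->
  (\int[Pi]_x g x = \int[mu]_(p in `]0%R, 1%R[) g (quantile Pi p))%E.
Proof.
move=> mg g0.
pose X : {RV unif >-> measurableTypeR R} := truncated_quantile.
rewrite (eq_measure_integral (distribution unif X)); last first.
  by move=> A mA _; exact: quantile_transform.
rewrite ge0_integral_distribution//.
have mgX : measurable_fun setT (g \o truncated_quantile).
  by apply: measurableT_comp => //; exact: measurable_truncated_quantile.
rewrite (integral_uniform _ mgX)//= subr0 invr1 mul1e integral_itv_bndoo; last first.
  exact: measurable_funTS.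
by apply: eq_integral => p; rewrite inE/= in_itv/= /truncated_quantile => ->.
Qed.

(** The transform is applied to the positive and negative parts separately; without a mean the two
    sides still agree, both being [fine] of the same extended real. *)
Lemma mean_quantile : mean Pi = \int[mu]_(p in `]0, 1[) quantile Pi p.
Proof.
rewrite /mean /Rintegral unlock; congr fine.
have mE : measurable_fun (setT : set R) (EFin : R -> \bar R) by exact: EFin_measurable.
rewrite [LHS]integralE [RHS]integralE; congr (_ - _)%E.
  rewrite (ge0_integral_quantile _ (measurable_funepos mE) (funepos_ge0 _)).
  by apply: eq_integral => p _; rewrite !funeposE.
rewrite (ge0_integral_quantile _ (measurable_funeneg mE) (funeneg_ge0 _)).
by apply: eq_integral => p _; rewrite !funenegE.
Qed.

End quantile.

(** * Integral of a monotone subgradient *)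

(* Telescoping over a uniform subdivision into n+1 intervals bounds |G d - G c| by
   (g d - g c) (d - c) / (n+1). *)
Lemma eq_of_oscillation (R : realType) (G g : R -> R) (c d : R) : c <= d ->
  (forall x y, c <= x -> x <= y -> y <= d -> `|G y - G x| <= (g y - g x) * (y - x)) ->
  G c = G d.
Proof.
move=> cd Gg.
have bound n : `|G d - G c| * n.+1%:R <= (g d - g c) * (d - c).
  pose e := (d - c) / n.+1%:R.
  pose x k := c + k%:R * e.
  have e0 : 0 <= e by rewrite divr_ge0// subr_ge0.
  have xnE : x n.+1 = d by rewrite /x /e mulrC divfK ?pnatr_eq0//; ring.
  have xS k : x k.+1 = x k + e by rewrite /x -natr1; ring.
  have x_nd k l : (k <= l)%N -> x k <= x l.
    by move=> kl; rewrite lerD2l ler_wpM2r// ler_nat.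
  have : forall k, (k <= n.+1)%N -> `|G (x k) - G c| <= (g (x k) - g c) * e.
    elim=> [_|k IH kn]; first by rewrite /x mul0r addr0 !subrr normr0 mul0r.
    have : `|G (x k.+1) - G (x k)| <= (g (x k.+1) - g (x k)) * (x k.+1 - x k).
      apply: Gg; rewrite ?x_nd// -?xnE ?x_nd//.
      by rewrite -[leLHS]addr0 lerD2l mulr_ge0.
    rewrite xS (_ : x k + e - x k = e); last by ring.
    move=> H1.
    have := IH (ltnW kn).
    have := ler_normD (G (x k + e) - G (x k)) (G (x k) - G c).
    rewrite addrA subrK; move: H1; lra.
  move=> /(_ _ (leqnn _)); rewrite xnE /e mulrA ler_pdivlMr//.
apply/eqP; rewrite eq_sym -subr_eq0 -normr_eq0; apply/negPn/negP => D0.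
have {}D0 : 0 < `|G d - G c| by rewrite lt_neqAle eq_sym D0 normr_ge0.
(* By the Archimedean property this n is too large for [bound]. *)
have := bound (Num.truncn ((g d - g c) * (d - c) / `|G d - G c|)).
by rewrite leNgt [X in _ < X]mulrC -ltr_pdivrMr// truncnS_gt.
Qed.

Lemma nondecreasing_in_measurable (R : realType) (a b : R) (g : R -> R) :
  (forall x y, a < x -> x <= y -> y < b -> g x <= g y) ->
  measurable_fun (`]a, b[ : set R) g.
Proof.
move=> gnd; apply: (measurability (@RGenInftyO.G R)) => [|/= _ [_ [x ->] <-]].
  exact: RGenInftyO.measurableE.
apply: is_interval_measurable => p q/=.
rewrite !in_itv/= => -[/andP[p0 p1]] px [/andP[q0 q1]] qx z /andP[pz zq].
rewrite !in_itv/= (lt_le_trans p0)//= (le_lt_trans zq)//; split => //.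
by rewrite (le_lt_trans _ qx)// gnd// (lt_le_trans p0).
Qed.

(** Monotone convergence along an exhaustion; finiteness of the limit L also yields integrability on
    the union. *)
Lemma ge0_set_cvg_Rintegral (R : realType) (F : (set (measurableTypeR R))^nat)
    (f : R -> R) (L : R) :
  nondecreasing_seq F -> (forall n, measurable (F n)) ->
  measurable_fun (\bigcup_n F n) f ->
  (forall x, (\bigcup_n F n) x -> 0 <= f x) ->
  (forall n, lebesgue_measure.-integrable (F n) (EFin \o f)) ->
  \int[lebesgue_measure]_(x in F n) f x @[n --> \oo] --> L ->
  lebesgue_measure.-integrable (\bigcup_n F n) (EFin \o f) /\
  \int[lebesgue_measure]_(x in \bigcup_n F n) f x = L.
Proof.
move=> ndF mF mf f0 intf fL.
have mEf : measurable_fun (\bigcup_n F n) (EFin \o f) by exact/measurable_EFinP.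
have c1 : (\int[lebesgue_measure]_(x in F n) (EFin \o f) x @[n --> \oo] -->
    \int[lebesgue_measure]_(x in \bigcup_n F n) (EFin \o f) x)%E.
  apply: ge0_nondecreasing_set_cvg_integral => //.
  - move=> n; apply: measurable_funS mEf; first exact: bigcup_measurable.
    exact: bigcup_sup.
  - by move=> n x Fx; rewrite lee_fin f0//; exists n.
have c2 : (\int[lebesgue_measure]_(x in F n) (EFin \o f) x @[n --> \oo] --> L%:E)%E.
  apply: cvg_EFin; last exact: fL.
  by apply: nearW => n; exact: (integrable_fin_num (mF n) (intf n)).
have E : (\int[lebesgue_measure]_(x in \bigcup_n F n) (EFin \o f) x = L%:E)%E.
  exact: cvg_unique c1 c2.
split; last by rewrite /Rintegral E.
apply/integrableP; split => //.
under eq_integral.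
  move=> x /[!inE] Dx; rewrite gee0_abs ?lee_fin ?f0//; over.
by rewrite E ltry.
Qed.

Lemma cst_integrable (R : realType) (D : set (measurableTypeR R)) (r : R) :
  measurable D -> (lebesgue_measure D < +oo)%E ->
  lebesgue_measure.-integrable D (EFin \o cst r).
Proof.
move=> mD Dy; apply: measurable_bounded_integrable => //.
by exists `|r|; split; [exact: num_real|move=> M rM z _; exact: ltW].
Qed.

(** The sign s, 1 or -1, treats functions bounded below or above by k alike. Subtracting k,
    integrable on a set of finite measure, reduces to the nonnegative case. *)
Lemma one_sided_union_Rintegral (R : realType) (F : (set (measurableTypeR R))^nat)
    (g : R -> R) (k s L : R) :
  nondecreasing_seq F -> (forall n, measurable (F n)) ->
  (lebesgue_measure (\bigcup_n F n) < +oo)%E ->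
  measurable_fun (\bigcup_n F n) g ->
  s * s = 1 -> (forall x, (\bigcup_n F n) x -> 0 <= s * (g x - k)) ->
  (forall n, lebesgue_measure.-integrable (F n) (EFin \o g)) ->
  \int[lebesgue_measure]_(x in F n) g x @[n --> \oo] --> L ->
  lebesgue_measure.-integrable (\bigcup_n F n) (EFin \o g) /\
  \int[lebesgue_measure]_(x in \bigcup_n F n) g x = L.
Proof.
set mu := lebesgue_measure; set D := \bigcup_n F n.
move=> ndF mF Dy mg ss gk intg gL.
have mD : measurable D by exact: bigcup_measurable.
have Fy n : (mu (F n) < +oo)%E.
  by rewrite (le_lt_trans _ Dy)// le_measure ?inE//; exact: bigcup_sup.
have Ik := @cst_integrable R D k mD Dy.
have Ikn n := @cst_integrable R (F n) k (mF n) (Fy n).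
have Igk n : mu.-integrable (F n) (EFin \o (fun x => g x - k)).
  exact: (integrableB (mF n) (intg n) (Ikn n)).
have [If Ef] : mu.-integrable D (EFin \o (fun x => s * (g x - k))) /\
    \int[mu]_(x in D) (s * (g x - k)) = s * (L - k * fine (mu D)).
  apply: ge0_set_cvg_Rintegral => //.
  - apply: measurable_funM; first exact: measurable_cst.
    by apply: measurable_funB => //; exact: measurable_cst.
  - by move=> n; exact: (integrableZl (mF n) s (Igk n)).
  - have -> : (fun n => \int[mu]_(x in F n) (s * (g x - k))) =
        (fun n => s * (\int[mu]_(x in F n) g x - k * fine (mu (F n)))).
      apply/funext => n; rewrite RintegralZl//.
      by rewrite RintegralB ?Rintegral_cst//; exact: Ikn.
    apply: cvgM; first exact: cvg_cst.
    apply: cvgB => //; apply: cvgM; first exact: cvg_cst.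
    apply: fine_cvg; rewrite fineK ?ge0_fin_numE//.
    exact: nondecreasing_cvg_mu.
have gE : g = (fun x => s * (s * (g x - k)) + k).
  by apply/funext => x; rewrite mulrA ss mul1r subrK.
have Isf := integrableZl mD s If.
split; first by rewrite gE; exact: (integrableD mD Isf Ik).
rewrite gE RintegralD//.
rewrite RintegralZl// Ef Rintegral_cst//.
by rewrite mulrA ss mul1r; ring.
Qed.

Section subgradient.
Context {R : realType} (a b : R) (H g : R -> R).
Local Notation mu := (@lebesgue_measure R).
Hypothesis ab : a < b.
Hypothesis cH : {within `[a, b], continuous H}.
Hypothesis Hg : forall x y, a < x -> x < y -> y < b ->
  g x * (y - x) <= H y - H x <= g y * (y - x).

Let g_nd x y : a < x -> x <= y -> y < b -> g x <= g y.
Proof.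
move=> ax; rewrite le_eqVlt => /predU1P[->//|xy] yb.
have /andP[+ +] := Hg _ _ ax xy yb => /le_trans/[apply].
by rewrite ler_pM2r// subr_gt0.
Qed.

Let g_measurable : measurable_fun (`]a, b[ : set R) g.
Proof. exact: nondecreasing_in_measurable. Qed.

Let g_integrable c d : a < c -> c <= d -> d < b ->
  mu.-integrable `[c, d] (EFin \o g).
Proof.
move=> ac cd db; apply: measurable_bounded_integrable => //.
- by rewrite /= lebesgue_measure_itv/=; case: ifPn => //; rewrite -?EFinB ltry.
- apply: measurable_funS g_measurable => //.
  by apply: subset_itv; rewrite bnd_simp.
- exists (`|g c| + `|g d|); split; first exact: num_real.
  move=> M cM x /=; rewrite in_itv/= => /andP[cx xd].
  rewrite (le_trans _ (ltW cM))// ler_norml.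
  have := g_nd _ _ ac cx (le_lt_trans xd db).
  have := g_nd _ _ (lt_le_trans ac cx) xd db.
  have := ler_norm (g d); have := ler_norm (- g c); rewrite normrN.
  have := normr_ge0 (g c); have := normr_ge0 (g d).
  by move=> *; apply/andP; split; lra.
Qed.

(** The increment of H and the integral of g over [x, y] both lie between [g x * (y - x)] and
    [g y * (y - x)], so their difference falls under [eq_of_oscillation]. *)
Lemma subgradient_Rintegral_itv c d : a < c -> c <= d -> d < b ->
  \int[mu]_(x in `[c, d]) g x = H d - H c.
Proof.
move=> ac cd db.
have : H c - \int[mu]_(x in `[c, c]) g x = H d - \int[mu]_(x in `[c, d]) g x.
  apply: (@eq_of_oscillation R (fun x => H x - \int[mu]_(x in `[c, x]) g x) g) => //.
  move=> x y cx xy yd.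
  have [ax yb] := (lt_le_trans ac cx, le_lt_trans yd db).
  have split_y : \int[mu]_(z in `[c, y]) g z - \int[mu]_(z in `[c, x]) g z =
      \int[mu]_(z in `]x, y]) g z.
    apply: Rintegral_itvB; rewrite ?bnd_simp//.
    exact: g_integrable (le_trans cx xy) yb.
  rewrite (_ : _ - _ = H y - H x - \int[mu]_(z in `]x, y]) g z); last first.
    by rewrite -split_y; ring.
  have ig : mu.-integrable `]x, y] (EFin \o g).
    apply: integrableS (g_integrable _ _ ax xy yb) => //.
    by apply: subset_itv; rewrite bnd_simp.
  have Ic (r : R) : mu.-integrable `]x, y] (EFin \o cst r).
    apply: measurable_bounded_integrable => //.
      by rewrite /= lebesgue_measure_itv/=; case: ifPn => //; rewrite -?EFinB ltry.
    by exists `|r|; split; [exact: num_real|move=> M rM z _; exact: ltW].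
  have Ir (r : R) : \int[mu]_(z in `]x, y]) r = r * (y - x).
    rewrite Rintegral_cst//= lebesgue_measure_itv/= lte_fin; case: ifPn => [//|].
    by rewrite -leNgt => yx; rewrite (@le_anti _ _ x y) ?xy// subrr !mulr0.
  have L : g x * (y - x) <= \int[mu]_(z in `]x, y]) g z.
    rewrite -Ir; apply: le_Rintegral => //; first exact: Ic.
    move=> z /=; rewrite in_itv/= => /andP[xz zy].
    by rewrite g_nd ?(ltW xz)// (le_lt_trans zy).
  have U : \int[mu]_(z in `]x, y]) g z <= g y * (y - x).
    rewrite -Ir; apply: le_Rintegral => //; first exact: Ic.
    move=> z /=; rewrite in_itv/= => /andP[xz zy].
    by rewrite g_nd ?(lt_trans ax).
  have : g x * (y - x) <= H y - H x <= g y * (y - x).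
    move: xy; rewrite le_eqVlt => /predU1P[<-|xy]; first by rewrite !subrr !mulr0 lexx.
    exact: Hg.
  move: (Rintegral _ _ _) L U => I L U.
  by move=> /andP[L' U']; rewrite ler_norml; apply/andP; split; lra.
by rewrite set_itv1 Rintegral_set1; lra.
Qed.

Let c := (a + b) / 2.
(** The shift makes [e 0] a third of the length, so the midpoint c stays strictly inside every
    truncated interval. *)
Let e n : R := (b - a) * harmonic (n + 2)%N.

Let e_gt0 n : 0 < e n. Proof. by rewrite mulr_gt0 ?subr_gt0// harmonic_gt0. Qed.

Let e_nincr m n : (m <= n)%N -> e n <= e m.
Proof. by move=> mn; rewrite ler_wpM2l ?subr_ge0 ?(ltW ab)// lef_pV2 ?posrE// ler_nat !addn2. Qed.

Let e_lt n : a + e n < c /\ c < b - e n.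
Proof.
have : e n <= (b - a) / 3 by exact: (e_nincr _ _ (leq0n n)).
by have := ab; rewrite /c => ? ?; split; lra.
Qed.

Let e_cvg : e n @[n --> \oo] --> 0.
Proof.
rewrite -(mulr0 (b - a)); apply: cvgM; first exact: cvg_cst.
rewrite (cvg_shiftn 2 (@harmonic R)).
exact: cvg_harmonic.
Qed.

Let left_union : \bigcup_n `[a + e n, c]%classic = `]a, c]%classic.
Proof.
apply/seteqP; split=> [x [n _ /=]|x /=]; rewrite !in_itv/=.
  by move=> /andP[nx ->]; rewrite andbT (lt_le_trans _ nx)// ltrDl.
move=> /andP[ax xc]; have xa : 0 < x - a by rewrite subr_gt0.
have [n _ ne] : \forall n \near \oo, e n < x - a by exact: (cvgr_lt _ e_cvg).
by exists n => //=; rewrite in_itv/= xc andbT; have := ne n (leqnn n); lra.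
Qed.

Let right_union : \bigcup_n `]c, b - e n]%classic = `]c, b[%classic.
Proof.
apply/seteqP; split=> [x [n _ /=]|x /=]; rewrite !in_itv/=.
  by move=> /andP[-> nx]; rewrite (le_lt_trans nx)// ltrBlDr ltrDl.
move=> /andP[cx xb]; have xa : 0 < b - x by rewrite subr_gt0.
have [n _ ne] : \forall n \near \oo, e n < b - x by exact: (cvgr_lt _ e_cvg).
by exists n => //=; rewrite in_itv/= cx/=; have := ne n (leqnn n); lra.
Qed.

Let Ha : H (a + e n) @[n --> \oo] --> H a.
Proof.
have [_ /cvg_at_rightP + _] := (continuous_within_itvP _ ab).1 cH; apply; split.
  by move=> n; rewrite ltrDl.
by rewrite -[X in _ --> X]addr0; apply: cvgD => //; exact: cvg_cst.
Qed.

Let Hb : H (b - e n) @[n --> \oo] --> H b.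
Proof.
have [_ _ /cvg_at_leftP] := (continuous_within_itvP _ ab).1 cH; apply; split.
  by move=> n; rewrite ltrBlDr ltrDl.
by rewrite -[X in _ --> X]subr0; apply: cvgB => //; exact: cvg_cst.
Qed.

Let ac : a < c. Proof. by have := ab; rewrite /c; lra. Qed.
Let cb : c < b. Proof. by have := ab; rewrite /c; lra. Qed.

Let itv_lty (x y : R) (i j : bool) :
  (mu [set` Interval (BSide i x) (BSide j y)] < +oo)%E.
Proof. by rewrite /= lebesgue_measure_itv/=; case: ifPn => //; rewrite -?EFinB ltry. Qed.

Let left_part : mu.-integrable `]a, c] (EFin \o g) /\
  \int[mu]_(x in `]a, c]) g x = H c - H a.
Proof.
(* To the left of c, monotonicity bounds g above by [g c]: hence the sign -1. *)
rewrite -left_union; apply: (@one_sided_union_Rintegral R _ g (g c) (- 1)).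
- by move=> m n mn; apply/subsetPset; apply: subset_itvr; rewrite bnd_simp lerD2l e_nincr.
- by move=> n; exact: measurable_itv.
- by rewrite left_union itv_lty.
- rewrite left_union; apply: measurable_funS g_measurable => //.
  by apply: subset_itvl; rewrite bnd_simp.
- by rewrite mulrNN mulr1.
- move=> x; rewrite left_union /= in_itv/= => /andP[ax xc].
  by rewrite mulN1r opprB subr_ge0 g_nd.
- by move=> n; apply: g_integrable => //; [rewrite ltrDl|case: (e_lt n) => /ltW].
- have -> : (fun n => \int[mu]_(x in `[a + e n, c]) g x) = (fun n => H c - H (a + e n)).
    apply/funext => n; apply: subgradient_Rintegral_itv => //; first by rewrite ltrDl.
    by case: (e_lt n) => /ltW.
  by apply: cvgB => //; exact: cvg_cst.
Qed.

Let right_part : mu.-integrable `]c, b[ (EFin \o g) /\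
  \int[mu]_(x in `]c, b[) g x = H b - H c.
Proof.
have Ig n : mu.-integrable `]c, b - e n] (EFin \o g).
  apply: integrableS (g_integrable c (b - e n) ac _ _) => //.
  - by apply: subset_itvr; rewrite bnd_simp.
  - by case: (e_lt n) => _ /ltW.
  - by rewrite ltrBlDr ltrDl.
rewrite -right_union; apply: (@one_sided_union_Rintegral R _ g (g c) 1).
- by move=> m n mn; apply/subsetPset; apply: subset_itvl; rewrite bnd_simp lerD2l lerN2 e_nincr.
- by move=> n; exact: measurable_itv.
- by rewrite right_union itv_lty.
- rewrite right_union; apply: measurable_funS g_measurable => //.
  by apply: subset_itvr; rewrite bnd_simp ltW.
- by rewrite mulr1.
- move=> x; rewrite right_union /= in_itv/= => /andP[cx xb].
  by rewrite mul1r subr_ge0 g_nd// ltW.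
- exact: Ig.
- have -> : (fun n => \int[mu]_(x in `]c, b - e n]) g x) = (fun n => H (b - e n) - H c).
    apply/funext => n; rewrite (Rintegral_itv_obnd_cbnd (Ig n)).
    apply: subgradient_Rintegral_itv => //; last by rewrite ltrBlDr ltrDl.
    by case: (e_lt n) => _ /ltW.
  by apply: cvgB => //; exact: cvg_cst.
Qed.

(** Although g may be unbounded at both ends, on each half it is bounded on one side, so truncated
    integrals pass to the limit by continuity of H at a and b. *)
Lemma subgradient_Rintegral : mu.-integrable `]a, b[ (EFin \o g) /\
  \int[mu]_(x in `]a, b[) g x = H b - H a.
Proof.
have [Il El] := left_part; have [Ir Er] := right_part.
have ab_split : `]a, b[%classic = `]a, c] `|` `]c, b[.
  by rewrite -itv_bndbnd_setU// bnd_simp ?ltW// ltW.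
have disj_c : [disjoint `]a, c]%classic & `]c, b[%classic].
  apply/disj_setPS => y [/=]; rewrite 2!in_itv/= => /andP[_ yx] /andP[].
  by rewrite ltNge yx.
have I : mu.-integrable `]a, b[ (EFin \o g).
  have mEg : measurable_fun (`]a, b[ : set R) (EFin \o g) by exact/measurable_EFinP.
  apply/integrableP; split => //; rewrite ab_split in mEg *.
  rewrite ge0_integral_setU//; last exact: measurableT_comp.
  by rewrite lte_add_pinfty//; [case/integrableP: Il|case/integrableP: Ir].
split => //; rewrite ab_split Rintegral_setU// -?ab_split//.
by rewrite El Er; ring.
Qed.

End subgradient.

(** * Agents' weighting functions *)

(** By concavity every difference quotient along the segment from x to y is at least [f y - f x];
    the derivative is their limit. *)
Lemma concave_chord_slope (R : realType) (f : R -> R) (x y d : R) :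
  convex_function (`[0, 1]%classic : set R^o) (fun x : R^o => - f x) ->
  0 <= x <= 1 -> 0 <= y <= 1 ->
  is_derive (x : R^o) 1 (f : R^o -> R^o) d -> f y - f x <= d * (y - x).
Proof.
move=> cf x01 y01 fx.
rewrite leNgt; apply/negP => dlt.
pose phi (s : R) := f (s * (y - x) + x).
have dphi : is_derive (0 : R^o) 1 (phi : R^o -> R^o) (d * (y - x)).
  apply: (@is_derive1_comp _ f (fun s => s * (y - x) + x) 0).
    by rewrite mul0r add0r.
  by apply: is_derive_eq; rewrite /GRing.scale/=; ring.
have [/cvg_ex[l /= phil] dphiE] := dphi.
have {l phil}phil : (fun s : R => s^-1 *: (phi (s *: 1 + 0) - phi 0)) @ 0^' --> d * (y - x).
  by rewrite -dphiE /derive; rewrite (cvg_lim _ phil).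
have [e /= e0 es] : \forall s \near 0^', s^-1 *: (phi (s *: 1 + 0) - phi 0) < f y - f x.
  exact: (cvgr_lt _ phil).
(* Small enough for the quotient to be near its limit, and at most 1 to be a convex weight. *)
pose s : R := Num.min (e / 2) 1.
have s0 : 0 < s by rewrite lt_min divr_gt0//=.
have s1 : s <= 1 by rewrite ge_min lexx orbT.
have se : s < e by rewrite gt_min ltr_pdivrMr// ltr_pMr// ltr1n.
have := es s; rewrite /ball_/= sub0r normrN gtr0_norm// => /(_ se).
rewrite gt_eqF// => /(_ isT).
rewrite addr0 /phi mul0r add0r /GRing.scale/= mulr1 ltr_pdivrMl//.
apply/negP; rewrite -leNgt.
have s01 : 0 <= s <= 1 by rewrite ltW.
have := cf (Itv01 (ltW s0) s1) y x.
rewrite !inE/= !in_itv/= => /(_ y01 x01).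
have -> : conv (Itv01 (ltW s0) s1) (y : convex_lmodType R^o) x = s * (y - x) + x.
  by rewrite /conv/= /unstable.onem /GRing.scale/=; ring.
rewrite convRE/= /unstable.onem.
lra.
Qed.

Lemma ae_itv_witness (R : realType) (Q : R -> Prop) (a b : R) : a < b ->
  (\forall x \ae (@lebesgue_measure R), Q x) -> exists2 x, a < x < b & Q x.
Proof.
move=> ab [N [mN N0 QN]]; apply: contrapT => noQ.
have : (@lebesgue_measure R `]a, b[ <= lebesgue_measure N)%E.
  apply: le_measure; rewrite ?inE// => x /=; rewrite in_itv/= => abx.
  by apply: QN => /= Qx; apply: noQ; exists x.
by rewrite N0 lebesgue_measure_itv/= lte_fin ab -EFinB lee_fin leNgt subr_gt0 ab.
Qed.

(** [dh] is the derivative only almost everywhere. At an arbitrary point, a failing inequality would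
    persist nearby by continuity of h, hence at a point of differentiability, against
    [concave_chord_slope]. *)
Lemma agent_supergradient (R : realType) (T : R) (A : agent T) :
  (forall x y, 0 < x -> x <= y -> y < 1 -> dh A y <= dh A x) ->
  forall x y, 0 < x -> x < y -> y < 1 ->
    dh A y * (y - x) <= h A y - h A x <= dh A x * (y - x).
Proof.
move=> dh_ni x y x0 xy y1.
have ch : {in `]0, 1[, continuous (h A)}.
  by have [] := (continuous_within_itvP (h A) ltr01).1 (@h_continuous _ _ A).
have slope u v : 0 < u -> u < 1 -> 0 <= v <= 1 ->
    is_derive (u : R^o) 1 (h A : R^o -> R^o) (dh A u) ->
    h A v - h A u <= dh A u * (v - u).
  move=> u0 u1 v01 du; apply: concave_chord_slope (@h_concave _ _ A) _ v01 du.
  by rewrite !ltW.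
have lin (k u v : R) : k * (v - z) @[z --> u] --> k * (v - u).
  by apply: cvgM; [exact: cvg_cst|apply: cvgB; [exact: cvg_cst|exact: cvg_id]].
apply/andP; split; rewrite leNgt; apply/negP => gt0.
- have F0 : \forall z \near y, 0 < h A x - h A z - dh A y * (x - z).
    have l0 : 0 < h A x - h A y - dh A y * (x - y) by lra.
    suff cF : h A x - h A z - dh A y * (x - z) @[z --> y] -->
        h A x - h A y - dh A y * (x - y) by exact: (cvgr_gt _ cF).
    apply: cvgB; last exact: lin.
    by apply: cvgB; [exact: cvg_cst|apply: ch; rewrite in_itv/= (lt_trans x0)].
  have [e /= e0 eF] := F0.
  (* z is taken to the left of y, so [dh A z >= dh A y] while [x - z < 0]. *)
  have xy' : Num.max x (y - e) < y by rewrite gt_max xy/= ltrBlDr ltrDl.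
  have [z /andP[]] := ae_itv_witness _ _ _ _ xy' (@h_derive _ _ A).
  rewrite gt_max => /andP[xz ez] zy dz.
  have z01 : 0 < z < 1 by rewrite (lt_trans x0)//= (lt_trans zy).
  have [z0 z1] := andP z01.
  have x01 : 0 <= x <= 1 by rewrite !ltW// (lt_trans xy).
  have := slope z x z0 z1 x01 (dz z01).
  have : 0 < h A x - h A z - dh A y * (x - z).
    by apply: eF; rewrite /ball_/= gtr0_norm ?subr_gt0//; lra.
  have := dh_ni z y z0 (ltW zy) y1.
  nra.
- have F0 : \forall z \near x, 0 < h A y - h A z - dh A x * (y - z).
    have l0 : 0 < h A y - h A x - dh A x * (y - x) by lra.
    suff cF : h A y - h A z - dh A x * (y - z) @[z --> x] -->
        h A y - h A x - dh A x * (y - x) by exact: (cvgr_gt _ cF).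
    apply: cvgB; last exact: lin.
    by apply: cvgB; [exact: cvg_cst|apply: ch; rewrite in_itv/= x0 (lt_trans xy)].
  have [e /= e0 eF] := F0.
  (* z is taken to the right of x, so [dh A z <= dh A x] while [y - z > 0]. *)
  have xy' : x < Num.min y (x + e) by rewrite lt_min xy/= ltrDl.
  have [z /andP[+ +]] := ae_itv_witness _ _ _ _ xy' (@h_derive _ _ A).
  rewrite lt_min => xz /andP[zy ze] dz.
  have z01 : 0 < z < 1 by rewrite (lt_trans x0)//= (lt_trans zy).
  have [z0 z1] := andP z01.
  have y01 : 0 <= y <= 1 by rewrite !ltW// (lt_trans x0).
  have := slope z y z0 z1 y01 (dz z01).
  have : 0 < h A y - h A z - dh A x * (y - z).
    by apply: eF; rewrite /ball_/= ltr0_norm ?subr_lt0//; lra.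
  have := dh_ni x z x0 (ltW xz) z1.
  nra.
Qed.

(** The reflection [- h A (1 - p)] has the subgradient [dh A (1 - p)], and it vanishes at both
    ends. *)
Lemma integral_dh (R : realType) (T : R) (A : agent T) :
  (forall x y, 0 < x -> x <= y -> y < 1 -> dh A y <= dh A x) ->
  lebesgue_measure.-integrable `]0, 1[ (EFin \o (fun p => dh A (1 - p))) /\
  \int[lebesgue_measure]_(p in `]0, 1[) dh A (1 - p) = 0.
Proof.
move=> /agent_supergradient sg.
have [|x y x0 xy y1|I E] := @subgradient_Rintegral R 0 1
    (fun p => - h A (1 - p)) (fun p => dh A (1 - p)) ltr01.
- have [ci c0 c1] := (continuous_within_itvP (h A) ltr01).1 (@h_continuous _ _ A).
  apply/(continuous_within_itvP _ ltr01); split.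
  + move=> x; rewrite in_itv/= => x01; apply: cvgN.
    apply: (@continuous_comp _ _ _ (fun p : R => 1 - p) (h A)).
      by apply: cvgB; [exact: cvg_cst|exact: cvg_id].
    by apply: ci; rewrite in_itv/=; lra.
  + apply: cvgN; rewrite subr0; apply/cvg_at_rightP => u [u0 ucvg].
    move/cvg_at_leftP: c1; apply; split; first by move=> n; have := u0 n; lra.
    by rewrite -[X in _ --> X]subr0; apply: cvgB => //; exact: cvg_cst.
  + apply: cvgN; rewrite subrr; apply/cvg_at_leftP => u [u0 ucvg].
    move/cvg_at_rightP: c0; apply; split; first by move=> n; have := u0 n; lra.
    by rewrite -[X in _ --> X](subrr 1); apply: cvgB => //; exact: cvg_cst.
- have := sg (1 - y) (1 - x); lra.
- by split=> //; rewrite E subrr subr0 h_0 h_1 subrr.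
Qed.

Lemma mean_shifted_derivative (R : realType) (T : R) (A : agent T) (Pi : prob_on R)
    (c theta : R) :
  (forall x y, 0 < x -> x <= y -> y < 1 -> dh A y <= dh A x) ->
  (forall p, 0 < p < 1 -> quantile Pi p = c + theta * dh A (1 - p)) ->
  mean Pi = c.
Proof.
move=> /integral_dh[I E] q.
rewrite mean_quantile.
transitivity (\int[lebesgue_measure]_(p in `]0, 1[) (c + theta * dh A (1 - p))).
  by apply: eq_Rintegral => p; rewrite inE/= in_itv/= => /q.
have m01 : (@lebesgue_measure R `]0%R, 1%R[ < +oo)%E.
  by rewrite /= lebesgue_measure_itv/= lte_fin ltr01 -EFinB ltry.
rewrite RintegralD//; [|exact: cst_integrable|exact: (integrableZl _ _ I)].
rewrite Rintegral_cst// RintegralZl// E mulr0 addr0.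
by rewrite /= lebesgue_measure_itv/= lte_fin ltr01 -EFinB/= subr0 mulr1.
Qed.

(** * Convergence of the simultaneous iteration *)

Theorem theorem4 (R : realType)
    (d : measure_display) (Omega : measurableType d) (P : probability Omega R)
    (F : R -> set (set Omega)) (W : noise -> R -> Omega -> R)
    (m : market R) (ag : 'I_2 -> agent (horizon m))
    (Pi : nat -> 'I_2 -> R -> R -> prob_on R)
    (a1 a2 : 'I_2 -> nat -> R -> R) (theta0 : 'I_2 -> R) :
  filtration F ->
  brownian_noise P F W ->
  profile P F W ag (fun i t _ y => Pi 0%N i t y) ->
  (forall i, coef_recursion ag i (a1 i) (a2 i)) ->
  (forall i j : 'I_2, i != j -> forall t y p : R,
     0 <= t <= horizon m -> 0 < p < 1 ->
     quantile (Pi 0%N i t y) p =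
     response_quantile ag i (mean (Pi 0%N j t y)) (a1 i 0%N t) (a2 i 0%N t)
       (theta0 i) y p) ->
  (forall (n : nat) (i j : 'I_2), i != j -> forall t y p : R,
     0 <= t <= horizon m -> 0 < p < 1 ->
     quantile (Pi n.+1 i t y) p =
     response_quantile ag i (mean (Pi n j t y)) (a1 i n.+1 t) (a2 i n.+1 t)
       (lambda (ag i) t / (gamma (ag i) * sigma m ^+ 2)) y p) ->
  forall i j : 'I_2, i != j ->
  forall K : set R, compact K ->
  {uniform `[0, horizon m] `*` K `*` `]0, 1[,
    (fun (n : nat) (z : R * R * R) => quantile (Pi n i z.1.1 z.1.2) z.2) @ \oo -->
    (fun z : R * R * R =>
       let t := z.1.1 in let y := z.1.2 in let p := z.2 in
       (1 - kappa (ag i) * kappa (ag j))^-1 *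
       (y / sigma m * ((gamma (ag i))^-1 + kappa (ag i) / gamma (ag j))
        - rho m * vol m / sigma m *
          ((a2_star ag i t + kappa (ag i) * a2_star ag j t) * y
           + (a1_star ag i t + kappa (ag i) * a1_star ag j t)))
       + lambda (ag i) t / (gamma (ag i) * sigma m ^+ 2) * dh (ag i) (1 - p))}.
Proof.
move=> _ _ _ rec q0 qS i j ij K cK.
have ord2 (k l : 'I_2) : k != l -> l = rev_ord k.
  by case: k => -[|[|//]] ?; case: l => -[|[|//]] ? //= _; exact: val_inj.
have other (k : 'I_2) : k != rev_ord k by case: k => -[|[|//]] ?.
have th_gt0 k t : 0 <= t <= horizon m ->
    0 < lambda (ag k) t / (gamma (ag k) * sigma m ^+ 2).
  by move=> tT; rewrite divr_gt0 ?lambda_gt0// mulr_gt0 ?gamma_gt0// exprn_gt0 ?sigma_gt0.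
(* Read off the monotone quantile function of the first update at time 0 and state 0. The initial
   policy would not do, the sign of [theta0] being unknown. *)
have dh_ni k x y : 0 < x -> x <= y -> y < 1 -> dh (ag k) y <= dh (ag k) x.
  move=> x0 xy y1.
  have T0 : (0 : R) <= 0 <= horizon m by rewrite lexx ltW ?horizon_gt0.
  have [y01 x01] : 0 < 1 - y < 1 /\ 0 < 1 - x < 1 by split; lra.
  have := @quantile_nondecreasing R (Pi 1%N k 0 0) (1 - y) (1 - x).
  rewrite !(qS 0%N k (rev_ord k) (other k))// /response_quantile !subKr.
  have /andP[-> _] := y01; have /andP[_ ->] := x01.
  rewrite lerD2l lerN2 xy => /(_ isT isT isT).
  by rewrite lerD2l ler_pM2l// th_gt0.
pose base k (u : R * R) := u.2 / (gamma (ag k) * sigma m)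
  - rho m * vol m / sigma m * (a2_star ag k u.1 * u.2 + a1_star ag k u.1).
(* The solution of the two-agent system of limiting means, checked in [mstarE]; [rev_ord k] is the
   opponent. *)
pose mstar k u := (base k u + kappa (ag k) * base (rev_ord k) u) /
  (1 - kappa (ag k) * kappa (ag (rev_ord k))).
have kk k : 1 - kappa (ag k) * kappa (ag (rev_ord k)) != 0.
  have /andP[k0 k1] := kappa_itv (ag k).
  have /andP[l0 l1] := kappa_itv (ag (rev_ord k)).
  by rewrite gt_eqF// subr_gt0 mulr_ilt1// ltW.
have mstarE k u : mstar k u = kappa (ag k) * mstar (rev_ord k) u + base k u.
  rewrite /mstar rev_ordK [kappa (ag (rev_ord k)) * kappa (ag k)]mulrC.
  by field; exact: kk.
pose D : set (R * R) := `[0, horizon m] `*` K.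
(* w collects the coefficient errors and x below the errors of the means; they satisfy the relations
   required by [coupled_decay]. *)
pose w n k (u : R * R) := - (rho m * vol m / sigma m) *
  ((a2 k n u.1 - a2_star ag k u.1) * u.2 + (a1 k n u.1 - a1_star ag k u.1)).
pose x n k (u : R * R) := mean (Pi n k u.1 u.2) - mstar k u.
have w_decay k : geometric_decay D (fun n => w n k).
  have [B [_ BK]] := compact_bounded cK.
  (* [compact_bounded] gives a bound by any number strictly above B, hence [B + 1]. *)
  apply: (@geometric_decay_lincomb _ _ _ _ _ _ snd (B + 1)).
  - by move=> [t y] [_ /= Ky]; apply: BK Ky; rewrite ltrDl.
  - have [C [r [? ? ? aC]]] := a2_decay _ _ _ (rec k).
    by exists C, r; split=> // n [t y] [/= tT _]; exact: aC.
  - have [C [r [? ? ? aC]]] := a1_decay _ _ _ (rec k).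
    by exists C, r; split=> // n [t y] [/= tT _]; exact: aC.
have x_decay k : geometric_decay D (fun n => x n k).
  apply: (coupled_decay D (fun k => kappa (ag k)) x w) => //.
  - by move=> l; exact: kappa_itv.
  - move=> l l' [t y] ll' [/=]; rewrite in_itv/= => tT _.
    rewrite (ord2 _ _ ll') /x mstarE.
    rewrite (@mean_shifted_derivative _ _ (ag l) _ _ _ (dh_ni l)
      (fun p => q0 l _ (other l) t y p tT)) /base /w/=; ring.
  - move=> n l l' [t y] ll' [/=]; rewrite in_itv/= => tT _.
    rewrite (ord2 _ _ ll') /x mstarE.
    rewrite (@mean_shifted_derivative _ _ (ag l) _ _ _ (dh_ni l)
      (fun p => qS n l _ (other l) t y p tT)) /base /w/=; ring.
have [C [r [C0 r0 r1 xC]]] := x_decay i.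
apply: geometric_decay_uniform; exists C, r; split=> // n [[t y] p] [[/= tT Ky] p01].
have tT' : 0 <= t <= horizon m by move: tT; rewrite in_itv.
have p01' : 0 < p < 1 by move: p01; rewrite /= in_itv.
have Dty : D (t, y) by [].
rewrite (le_trans _ (le_trans (xC n.+1 (t, y) Dty) _))//; last first.
  by rewrite ler_wpM2l// exprS ler_piMl ?exprn_ge0// ltW.
(* The exploration terms cancel, so for every p the quantile error equals the error of the mean:
   uniformity in p is free. *)
rewrite le_eqVlt; apply/orP; left; apply/eqP; congr (`| _ |).
rewrite (qS n i j ij)// /x/=.
rewrite (@mean_shifted_derivative _ _ (ag i) _ _ _ (dh_ni i)
      (fun p => qS n i j ij t y p tT')) /response_quantile /mstar /base/= (ord2 _ _ ij).
by field; rewrite kk !gt_eqF ?gamma_gt0 ?sigma_gt0.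
Qed.
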